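(* Let $(G,i)$ be a rooted graph with $G$ connected. The following are equivalent: (a) $(G,i)$ allows the nullity pair $(2,1)$ with the SNIP; (b) $(G,i)$ allows the nullity pair $(2,1)$; (c) $(G,i)$ contains $(K_3,i)$ or $(K_{1,3},\text{leaf})$ as a rooted minor; (d) $G$ is not a path, and $(G,i)$ is not a generalized star whose root $i$ is its center.
   Context: All matrices are real. For a simple graph $G$ on vertex set $[n]$, $\mathcal{S}(G)$ is the set of real symmetric $n\times n$ matrices whose $(j,k)$ entry for $j\ne k$ is nonzero iff $\{j,k\}\in E(G)$ (diagonal free). $A(i)$ is $A$ with row and column $i$ deleted; the $i$-nullity pair of $A$ is $(\operatorname{null}(A),\operatorname{null}(A(i)))$. $A$ has the $i$-SNIP if $X=O$ is the only real symmetric $X$ with $A\circ X=O$, $I\circ X=O$ (entrywise products) and $(AX)(i,:]=O$ ($AX$ with row $i$ deleted). A rooted graph $(G,i)$ allows $(k,\ell)$ (with the SNIP) if some $A\in\mathcal{S}(G)$ has $i$-nullity pair $(k,\ell)$ (and the $i$-SNIP). $(G,i)$ is a rooted minor of $(H,i)$ if obtainable from $(H,i)$ by edge deletions, deletions of isolated non-root vertices, and edge contractions (new vertex is the root if the contracted edge contains the root). $(K_3,i)$ is the triangle rooted at any vertex; $(K_{1,3},\text{leaf})$ is the star with three leaves rooted at a leaf. A high-degree vertex is a vertex of degree at least $3$; a generalized star is a tree with exactly one high-degree vertex, called its center. *)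

(* Defs.v *)
From mathcomp Require Import all_boot all_order all_algebra.
From mathcomp Require Import reals.
From Stdlib Require Import Relation_Operators.

Set Implicit Arguments.
Unset Strict Implicit.
Unset Printing Implicit Defensive.

Import GRing.Theory.
Local Open Scope ring_scope.

Record sgraph (n : nat) := SGraph {
  sg_adj :> rel 'I_n;
  sg_sym : symmetric sg_adj;
  sg_irr : irreflexive sg_adj
}.

Record rgraph := RGraph {
  rg_order : nat;
  rg_graph :> sgraph rg_order;
  rg_root : 'I_rg_order
}.

Section Matrices.
Variable R : realType.

Definition graph_matrix n (G : sgraph n) (A : 'M[R]_n) : Prop :=
  A^T = A /\ forall j k : 'I_n, j != k -> (A j k != 0) = G j k.

(* The column space of [cokermx A] is the null space {x | A *m x = 0}. *)
Definition nullity n (A : 'M[R]_n) : nat := \rank (cokermx A).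

Definition del_row_col n (A : 'M[R]_n) (i : 'I_n) : 'M[R]_n.-1 :=
  row' i (col' i A).

Definition nullity_pair n (A : 'M[R]_n) (i : 'I_n) : nat * nat :=
  (nullity A, nullity (del_row_col A i)).

Definition hadamard n (A B : 'M[R]_n) : 'M[R]_n := map2_mx *%R A B.

Definition SNIP n (A : 'M[R]_n) (i : 'I_n) : Prop :=
  forall X : 'M[R]_n,
    X^T = X -> hadamard A X = 0 -> hadamard 1%:M X = 0 ->
    row' i (A *m X) = 0 -> X = 0.

Definition allows n (G : sgraph n) (i : 'I_n) (k l : nat) : Prop :=
  exists A : 'M[R]_n, graph_matrix G A /\ nullity_pair A i = (k, l).

Definition allows_SNIP n (G : sgraph n) (i : 'I_n) (k l : nat) : Prop :=
  exists A : 'M[R]_n,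
    [/\ graph_matrix G A, nullity_pair A i = (k, l) & SNIP A i].

End Matrices.

(* Vertices are always relabelled as 0, ..., n-1, so each operation on a rooted
   graph H carries a map f between the vertex set of H and that of the result K.
   Contraction keeps graphs simple: the map f identifies exactly the ends u, v
   of the contracted edge, and loops and multiplicities are discarded. *)
Inductive rooted_minor_step (H K : rgraph) : Prop :=
| RelabelStep (f : 'I_(rg_order H) -> 'I_(rg_order K)) of
    bijective f & f (rg_root H) = rg_root K &
    (forall x y, K (f x) (f y) = H x y)
| EdgeDeletionStep (u v : 'I_(rg_order H))
    (f : 'I_(rg_order H) -> 'I_(rg_order K)) of
    H u v & bijective f & f (rg_root H) = rg_root K &
    (forall x y, K (f x) (f y) = H x y && ([set x; y] != [set u; v]))
| IsolatedVertexDeletionStep (v : 'I_(rg_order H))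
    (f : 'I_(rg_order K) -> 'I_(rg_order H)) of
    v != rg_root H & (forall x, ~~ H v x) &
    injective f & (forall x, (x \in codom f) = (x != v)) &
    f (rg_root K) = rg_root H & (forall x y, K x y = H (f x) (f y))
| EdgeContractionStep (u v : 'I_(rg_order H))
    (f : 'I_(rg_order H) -> 'I_(rg_order K)) of
    H u v & (forall a, a \in codom f) &
    (forall x y, (f x == f y) = (x == y) || ([set x; y] == [set u; v])) &
    f (rg_root H) = rg_root K &
    (forall a b, K a b =
       (a != b) && [exists x, exists y, [&& f x == a, f y == b & H x y]]).

Definition rooted_minor (K H : rgraph) : Prop :=
  clos_refl_trans rgraph rooted_minor_step H K.

Definition complete_adj n : rel 'I_n := fun x y => x != y.

Lemma complete_adj_sym n : symmetric (@complete_adj n).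
Proof. by move=> x y; rewrite /complete_adj eq_sym. Qed.

Lemma complete_adj_irr n : irreflexive (@complete_adj n).
Proof. by move=> x; rewrite /complete_adj eqxx. Qed.

Definition complete_graph n : sgraph n :=
  SGraph (@complete_adj_sym n) (@complete_adj_irr n).

(* The star with n leaves: the center is [ord0]. *)
Definition star_adj n : rel 'I_n.+1 := fun x y => (x == ord0) != (y == ord0).

Lemma star_adj_sym n : symmetric (@star_adj n).
Proof. by move=> x y; rewrite /star_adj eq_sym. Qed.

Lemma star_adj_irr n : irreflexive (@star_adj n).
Proof. by move=> x; rewrite /star_adj eqxx. Qed.

Definition star_graph n : sgraph n.+1 :=
  SGraph (@star_adj_sym n) (@star_adj_irr n).

Definition path_adj n : rel 'I_n :=
  fun x y => (x.+1 == y :> nat) || (y.+1 == x :> nat).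

Lemma path_adj_sym n : symmetric (@path_adj n).
Proof. by move=> x y; rewrite /path_adj orbC. Qed.

Lemma path_adj_irr n : irreflexive (@path_adj n).
Proof. by move=> x; rewrite /path_adj orbb; apply/negbTE; rewrite neq_ltn ltnSn orbT. Qed.

Definition path_graph n : sgraph n :=
  SGraph (@path_adj_sym n) (@path_adj_irr n).

Definition K3_rooted : rgraph := @RGraph 3 (complete_graph 3) ord0.

Definition K13_leaf : rgraph := @RGraph 4 (star_graph 3) ord_max.

Section Graphs.
Variables (n : nat) (G : sgraph n).

Definition connected_graph : Prop := forall x y : 'I_n, connect G x y.

Definition is_path : Prop :=
  exists2 f : 'I_n -> 'I_n,
    bijective f & forall x y, G (f x) (f y) = path_graph n x y.

Definition acyclic : Prop :=
  forall c : seq 'I_n, ucycle G c -> (size c <= 2)%N.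

Definition is_tree : Prop := connected_graph /\ acyclic.

Definition degree (v : 'I_n) : nat := #|[set w | G v w]|.

Definition high_degree (v : 'I_n) : bool := (3 <= degree v)%N.

Definition generalized_star_with_center (c : 'I_n) : Prop :=
  is_tree /\ [set v | high_degree v] = [set c].

End Graphs.

(* Main.v *)
Require Import Defs.
From mathcomp Require Import all_boot all_order all_algebra.
From mathcomp Require Import reals.
From mathcomp Require Import boolp ring.
From Stdlib Require Import Relation_Operators.

(** All four conditions are equivalent to the existence of a tripod at the root:
    two further vertices [b], [c] such that none of [i], [b], [c] separates the
    other two.

    Given a tripod, put [-1] on every edge and a diagonally dominant diagonal off
    the tripod. By the minimum principle the Schur complement onto [i], [b], [c]
    has nonzero off-diagonal entries, so its diagonal, which is free, can be
    chosen to make it of rank one. The kernel then has dimension 2 and does not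
    vanish at [i]. For such a matrix the SNIP condition on [X] forces [A X = 0],
    so that [X] is determined by its restriction to the tripod, and this
    restriction is zero.

    Conversely, without a tripod every non-root vertex has degree at most 2 and
    the neighbours of [i] lie in distinct components of [G - i]. The nullity pair
    [(2, 1)] gives a null vector [x] with [x_i <> 0] and a nonzero null vector
    [y] with [y_i = 0]. Restrict [y] to a component of [G - i] where it is not
    zero: pairing with [x] shows that the restriction is still a null vector, so
    it vanishes at the neighbour of [i] and then along the whole branch.

    Tripods lift along the minor operations. In a connected graph, contracting
    edges as long as a tripod survives ends in a triangle or a claw. *)

Set Implicit Arguments.
Unset Strict Implicit.
Unset Printing Implicit Defensive.

Import Order.TTheory GRing.Theory Num.Theory.

(** * Tripods *)

Lemma connect_preserved (T : finType) (e : rel T) (P : pred T) x y :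
  (forall a b, e a b -> P a -> P b) -> connect e x y -> P x -> P y.
Proof.
move=> Pe /connectP[p]; elim: p x => [|z p IHp] x /= => [_ -> //|].
by case/andP=> exz pathp lasty Px; apply: IHp lasty (Pe _ _ exz Px).
Qed.


Section Tripods.

Variables (n : nat) (G : sgraph n).
Implicit Types (S : {set 'I_n}) (x y a b c : 'I_n).

(** Adjacency in [G - S] on the unchanged vertex type: the members of [S] become isolated points. *)
Definition avoiding S : rel 'I_n :=
  [rel x y | [&& G x y, x \notin S & y \notin S]].

Lemma avoidingE S x y :
  avoiding S x y = [&& G x y, x \notin S & y \notin S].
Proof. by []. Qed.

Lemma avoiding_sym S : connect_sym (avoiding S).
Proof.
by apply: sym_connect_sym => x y; rewrite !avoidingE sg_sym; congr (_ && _); rewrite andbC.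
Qed.

Lemma avoiding_path S x p : path (avoiding S) x p ->
  path G x p /\ {in p, forall y, y \notin S}.
Proof.
elim: p x => [|z p IHp] x //= /andP[/and3P[-> _ zS] /IHp[-> pS]].
by split=> // y; rewrite inE => /predU1P[->//|/pS].
Qed.

Lemma path_avoiding S x p : path G x p ->
  {in x :: p, forall y, y \notin S} -> path (avoiding S) x p.
Proof.
move=> pathp xpS; have allp : all [pred y | y \notin S] (x :: p).
  by apply/allP => y /xpS.
apply: (sub_in_path _ allp pathp) => y z yS zS Gyz.
by rewrite !inE in yS zS; rewrite avoidingE Gyz yS.
Qed.

Definition tripod a b c : bool :=
  [&& [&& a != b, a != c & b != c], connect (avoiding [set a]) b c,
      connect (avoiding [set b]) a c & connect (avoiding [set c]) a b].

Lemma tripod_rot a b c : tripod a b c = tripod b c a.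
Proof.
rewrite /tripod [connect _ b a]avoiding_sym [connect _ c a]avoiding_sym.
rewrite [b == a]eq_sym [c == a]eq_sym.
by apply/idP/idP => /and4P[/and3P[-> -> ->] -> -> ->].
Qed.

Definition has_tripod a : bool := [exists b, exists c, tripod a b c].

Lemma has_tripodP a :
  reflect (exists b c, tripod a b c) (has_tripod a).
Proof.
by apply: (iffP existsP) => [[b /existsP[c abc]]|[b [c abc]]]; exists b;
  [exists c | apply/existsP; exists c].
Qed.

(* Walk from [x] to [C]; [z0] is the first vertex of [C] on that walk. *)
Lemma first_hit (C : pred 'I_n) x y :
  connect G x y -> C y ->
  exists z0, [/\ C z0, C x -> z0 = x &
    forall z, C z -> z != z0 -> connect (avoiding [set z]) x z0].
Proof.
case/connectP=> p + ->; elim: p x => [|w p IHp] x /=.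
  by move=> _ Cx; exists x; split=> // z _ _; apply: connect0.
case/andP=> Gxw /IHp{}IHp /IHp[z0 [Cz0 Cw_eq hit]].
have [Cx|nCx] := boolP (C x).
  by exists x; split=> // z _ _; apply: connect0.
exists z0; split=> // z Cz ne_zz0; apply: connect_trans (hit z Cz ne_zz0).
have xz : x != z by apply: contraNneq nCx => ->.
have wz : w != z by apply: contraNneq ne_zz0 => wz; rewrite Cw_eq wz.
by apply: connect1; rewrite avoidingE Gxw !inE xz.
Qed.

Variable i : 'I_n.
Hypothesis connG : connected_graph G.

(** Let [p] be the neighbour of [x] first reached from [i], and [q], [r] two other neighbours. The
    walk [q], [x], [r] avoids [i]; from [i] one reaches [x] through [p], hence each of [q], [r]
    without meeting the other. *)
Lemma high_degree_tripod x : x != i -> high_degree G x -> has_tripod i.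
Proof.
move=> ne_xi; rewrite /high_degree /degree => deg3.
have [y Gxy] : exists y, y \in [set w | G x w].
  by apply/set0Pn; rewrite -card_gt0 (leq_trans _ deg3).
have [p [Gxp hit_i hit]] := first_hit (connG i y) (Gxy : [in [set w | G x w]] y).
have [q [r [neqr Gq Gr]]] : exists q r, [/\ q != r,
    q \in [set w | G x w] :\ p & r \in [set w | G x w] :\ p].
  have : 1 < #|[set w | G x w] :\ p|.
    by move: deg3; rewrite (cardsD1 p) Gxp.
  by case/card_gt1P=> q [r [? ? ?]]; exists q, r.
move: Gq Gr; rewrite !in_setD1 => /andP[neqp Gq] /andP[nerp Gr].
(* A walk that starts among the neighbours of [x] hits them at once, so [q = i] would force
   [p = q]. *)
have neqi : q != i by apply: contraNneq neqp => qi; rewrite qi hit_i // -qi.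
have neri : r != i by apply: contraNneq nerp => ri; rewrite ri hit_i // -ri.
have ipxq s t : s \in [set w | G x w] -> t \in [set w | G x w] ->
    s != t -> t != p -> connect (avoiding [set t]) i s.
  move=> Gs Gt nest netp; apply: connect_trans (hit t Gt netp) _.
  have nxt : x != t by apply: contraTneq Gt => <-; rewrite inE sg_irr.
  apply: (@connect_trans _ _ x); apply: connect1; rewrite avoidingE !inE nxt.
    by move: Gxp; rewrite inE sg_sym => ->; rewrite eq_sym netp.
  by move: Gs; rewrite inE nest => ->.
apply/has_tripodP; exists q, r; rewrite /tripod neqr eq_sym neqi eq_sym neri /=.
rewrite ipxq // 1?eq_sym // ipxq // !andbT.
apply: (@connect_trans _ _ x); apply: connect1; rewrite avoidingE !inE ne_xi.
  by move: Gq; rewrite inE sg_sym neqi => ->.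
by move: Gr; rewrite inE neri => ->.
Qed.

(** Let [z] be the vertex of the cycle first reached from [i], and [q], [r] its two neighbours on
    the cycle. Through [z], the root reaches each of them without the other. The rest of the cycle
    joins [q] to [r] and misses [i], which can lie on the cycle only as [z]. *)
Lemma cycle_tripod (c : seq 'I_n) : ucycle G c -> 2 < size c -> has_tripod i.
Proof.
case/andP=> cycc uniqc gt2.
have [y yc] : exists y, y \in c by case: c gt2 {cycc uniqc} => // y s _; exists y; rewrite mem_head.
have [z [zc hit_i hit]] := first_hit (connG i y) (yc : [in c] y).
have [k s def_c] := rot_to zc.
move: cycc uniqc gt2; rewrite -(rot_cycle k) -(rot_uniq k) -(size_rot k) def_c /= => cycc.
have mem_c w : (w \in c) = (w \in z :: s) by rewrite -def_c mem_rot.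
case: s {def_c} cycc mem_c => [|q s]; first by [].
case/lastP: s => [|s r]; first by [].
rewrite /= rcons_path last_rcons => /and3P[Gzq pathqr Grz] mem_c.
case/andP=> zs uniqs _.
have qz : q != z by apply: contraNneq zs => <-; rewrite mem_head.
have rz : r != z.
  by apply: contraNneq zs => <-; rewrite inE mem_rcons mem_head orbT.
have qr : q != r by case/andP: uniqs; rewrite mem_rcons inE negb_or => /andP[].
have qc : q \in c by rewrite mem_c !inE eqxx orbT.
have rc : r \in c by rewrite mem_c !inE mem_rcons !inE eqxx !orbT.
have is' w : w \in q :: rcons s r -> w != i.
  move=> ws; apply: contraNneq zs => wi; rewrite hit_i -?wi //.
  by rewrite mem_c inE ws orbT.
apply/has_tripodP; exists q, r.
rewrite /tripod qr ![i == _]eq_sym !is' ?inE ?mem_rcons ?inE ?eqxx ?orbT //=.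
have izs u v : u \in c -> v \in c -> u != z -> v != z -> u != v -> G z u ->
    connect (avoiding [set v]) i u.
  move=> uc vc uz vz uv Gzu; apply: connect_trans (hit v vc vz) _.
  by apply: connect1; rewrite avoidingE !inE Gzu eq_sym vz uv.
have rq : r != q by rewrite eq_sym.
have Gzr : G z r by rewrite sg_sym.
apply/and3P; split; [|exact: izs|exact: izs].
apply/connectP; exists (rcons s r); last by rewrite last_rcons.
by apply: path_avoiding pathqr _ => a /is' ai; rewrite inE.
Qed.

End Tripods.

(** * Neighbours of vertices of degree at most two *)

Section Paths.

Variables (n : nat) (G : sgraph n).
Implicit Types (x y a b : 'I_n) (s t p : seq 'I_n).

Lemma low_degree_neighbors x a b y : ~~ high_degree G x ->
  G x a -> G x b -> a != b -> G x y -> (y == a) || (y == b).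
Proof.
move=> lowx Ga Gb ab Gy; apply: contraNT lowx; rewrite negb_or => /andP[ya yb].
apply/card_gt2P; exists a, b, y; rewrite !inE Ga Gb Gy ab eq_sym yb ya.
by [].
Qed.

Lemma inner_neighbors s1 a x b s2 y :
  sorted G (s1 ++ [:: a, x, b & s2]) -> uniq (s1 ++ [:: a, x, b & s2]) ->
  ~~ high_degree G x -> G x y -> y \in s1 ++ [:: a, x, b & s2].
Proof.
move=> sorts; rewrite cat_uniq => /and3P[_ _ /= /and3P[nax _ _]] lowx Gxy.
have Gax : G a x && G x b.
  case: s1 sorts => [|z s1] /=; first by case/and3P=> -> ->.
  by rewrite cat_path /= => /andP[_ /and4P[_ -> ->]].
case/andP: Gax => Gax Gxb.
have ab : a != b by move: nax; rewrite !inE !negb_or => /and3P[].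
rewrite sg_sym in Gax.
by case/orP: (low_degree_neighbors lowx Gax Gxb ab Gxy) => /eqP->;
  rewrite mem_cat !inE eqxx !orbT.
Qed.

End Paths.

(** * Graphs without tripods: paths and generalized stars *)

Section PathCharacterization.

Variables (n : nat) (G : sgraph n).
Hypothesis connG : connected_graph G.

Lemma maximal_path (i : 'I_n) : exists s : seq 'I_n,
  [/\ s != [::], sorted G s, uniq s &
      forall t, sorted G t -> uniq t -> size t <= size s].
Proof.
pose P k := [exists s : k.-tuple 'I_n, sorted G s && uniq s].
have exP : exists k, P k.
  by exists 1; apply/existsP; exists [tuple i].
have ubP k : P k -> k <= n.
  case/existsP=> s /andP[_ us]; rewrite -(size_tuple s) -(card_uniqP us).
  by rewrite -[X in _ <= X]card_ord max_card.
have [k Pk maxk] := ex_maxnP exP ubP; case/existsP: Pk => s /andP[sorts us].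
exists s; split=> // [|t sortt ut].
  rewrite -size_eq0 size_tuple -lt0n maxk //.
  by apply/existsP; exists [tuple i].
rewrite size_tuple maxk //; apply/existsP; exists (in_tuple t).
by rewrite sortt.
Qed.

(* A path of maximal length is closed under adjacency: its inner vertices have
   no other neighbours, its ends cannot be extended, and a chord between the
   ends would close a cycle. *)
Lemma low_degree_acyclic_is_path (i : 'I_n) : acyclic G ->
  (forall x, ~~ high_degree G x) -> is_path G.
Proof.
move=> acyG lowG; have [s [s0 sorts us maxs]] := maximal_path i.
case: s s0 sorts us maxs => // x0 s _; set t := x0 :: s => sortt ut maxt.
pose v := nth x0 t.
have adj k : k.+1 < size t -> G (v k) (v k.+1) by move=> lt; apply/(sortedP x0).
have v_inj k l : k < size t -> l < size t -> (v k == v l) = (k == l).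
  by move=> ? ?; rewrite /v nth_uniq.
have head_in y : G (v 0) y -> y \in t.
  move=> Gy; apply: contraT => ny; have := maxt (y :: t).
  rewrite cons_uniq ny ut -[sorted G (y :: t)]/(G y (v 0) && sorted G t).
  by rewrite sortt sg_sym Gy ltnn => /(_ isT isT).
have last_in y : G (v (size s)) y -> y \in t.
  move=> Gy; apply: contraT => ny; have := maxt (rcons t y).
  rewrite rcons_uniq ny ut size_rcons ltnn.
  have -> : sorted G (rcons t y) = path G x0 s && G (v (size s)) y.
    by rewrite /= rcons_path /v /t -[size s]/((size t).-1) nth_last.
  by rewrite Gy andbT => /(_ sortt isT).
have inner k y : 0 < k -> k < size s -> G (v k) y -> (y == v k.-1) || (y == v k.+1).
  case: k => // k _ ltk; apply: low_degree_neighbors => //.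
  - by rewrite sg_sym adj //= ltnS ltnW.
  - by apply: adj.
  - by rewrite v_inj /= ?ltnS ?(ltnW (ltnW ltk)) // neq_ltn (leqnSn k.+1).
have closed y k : k < size t -> G (v k) y -> y \in t.
  move=> ltk; have [->|k0] := posnP k; first exact: head_in.
  have [lt|ge] := ltnP k (size s).
    case/(inner _ _ k0 lt)/orP => /eqP ->; rewrite mem_nth //=.
      by rewrite (leq_ltn_trans (leq_pred k)).
  suff -> : k = size s by apply: last_in.
  by apply/eqP; rewrite eqn_leq ge andbT -ltnS.
have t_all y : y \in t.
  apply: (connect_preserved (P := [in t]) _ (connG x0 y)); last exact: mem_head.
  move=> a b Gab at_; apply: (closed b (index a t)); first by rewrite index_mem.
  by rewrite /v nth_index.
have sz : size t = n.
  rewrite -(card_uniqP ut) -[RHS]card_ord; apply: eq_card => y.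
  by rewrite t_all.
have Gv k l : k < l -> l < size t -> G (v k) (v l) = (k.+1 == l).
  move=> ltkl ltl; have ltk := ltn_trans ltkl ltl.
  apply/idP/eqP => [Gkl|<-]; last by rewrite adj // (leq_ltn_trans ltkl).
  have [k0|k0] := posnP k; last first.
    have ltks : k < size s by rewrite (leq_trans ltkl).
    case/orP: (inner _ _ k0 ltks Gkl); rewrite v_inj //.
    - by move/eqP=> El; move: ltkl; rewrite El ltnNge leq_pred.
    - by rewrite (leq_ltn_trans (leq_pred k)).
    - by move/eqP.
  rewrite {}k0 in ltkl ltk Gkl *.
  have [ls|ls] := ltnP l (size s).
    rewrite sg_sym in Gkl.
    case/orP: (inner _ _ ltkl ls Gkl); rewrite v_inj //.
    - by move/eqP; case: l ltkl {ltl Gkl ls} => // l _ /= <-.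
    - by rewrite (leq_ltn_trans (leq_pred l)).
  have El : l = size s by apply/eqP; rewrite eqn_leq ls andbT -ltnS.
  have : size t <= 2.
    apply: acyG; rewrite /ucycle /ucycleb ut andbT /= rcons_path.
    rewrite -[path G x0 s]/(sorted G t) sortt /=.
    have -> : last x0 s = v l by rewrite El /v -[size s]/((size t).-1) nth_last.
    by rewrite sg_sym.
  by rewrite /= ltnS -El => le1; apply/eqP; rewrite eqn_leq le1 ltkl.
have lt_t (k : 'I_n) : k < size t by rewrite sz.
exists (fun k : 'I_n => v k).
  apply: injF_bij => k l /eqP; rewrite v_inj // => /eqP; exact: val_inj.
move=> k l; rewrite /path_graph /= /path_adj; case: (ltngtP k l) => [lt|lt|eq].
- by rewrite Gv // [l.+1 == k]gtn_eqF ?orbF // ltnS ltnW.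
- by rewrite sg_sym Gv // [k.+1 == l]gtn_eqF // ltnS ltnW.
- by rewrite eq sg_irr orbb gtn_eqF.
Qed.

(** Cycles and non-root vertices of high degree both produce tripods, so the degree of the root
    decides between the two shapes. *)
Lemma no_tripod_shape (i : 'I_n) : ~~ has_tripod G i ->
  is_path G \/ generalized_star_with_center G i.
Proof.
move=> noT.
have acyG : acyclic G.
  move=> c cycc; rewrite leqNgt; apply: contra noT; exact: cycle_tripod cycc.
have lowG x : x != i -> ~~ high_degree G x.
  by move=> xi; apply: contra noT; apply: high_degree_tripod xi.
have [hi|lowi] := boolP (high_degree G i); [right|left].
  split=> //; apply/setP=> x; rewrite !inE; have [->//|xi] := eqVneq x i.
  by apply/negbTE/lowG.
apply: (low_degree_acyclic_is_path i) => // x.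
by have [->//|xi] := eqVneq x i; apply: lowG.
Qed.

(** The middle one of three vertices on a path separates the other two. *)
Lemma path_no_tripod a b c : is_path G -> ~~ tripod G a b c.
Proof.
case=> f [g fK gK] Gf.
have Gg x y : G x y = path_graph n (g x) (g y) by rewrite -Gf !gK.
(* Adjacent positions differ by one, so the positions below [g y] cannot be left without visiting
   [y]. *)
have sep x y z : g x < g y -> g y < g z -> ~~ connect (avoiding G [set y]) x z.
  move=> ltxy ltyz; apply/negP => xz.
  suff : g z < g y by rewrite ltnNge ltnW.
  apply: (connect_preserved (P := fun u => g u < g y) _ xz ltxy) => u w.
  rewrite avoidingE !inE Gg => /and3P[adj _ wy] ltu.
  have gwy : g w != g y :> nat.
    by apply: contraNneq wy => /val_inj /(can_inj gK) ->.
  rewrite ltn_neqAle gwy /=; case/orP: adj => /eqP; first by move=> <-.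
  by move=> Eu; apply: ltnW; apply: leq_trans ltu; rewrite -Eu.
have g_neq x y : x != y -> g x != g y :> nat.
  by apply: contraNneq => /val_inj /(can_inj gK) ->.
apply/negP => /and4P[/and3P[ab ac bc] bac abc acb].
move: (g_neq _ _ ab) (g_neq _ _ ac) (g_neq _ _ bc) => {}ab {}ac {}bc.
case: (ltngtP (g a) (g b)) ab => // [ltab|ltba] _.
  case: (ltngtP (g b) (g c)) bc => // [ltbc|ltcb] _.
    by move: (sep _ _ _ ltab ltbc); rewrite abc.
  case: (ltngtP (g a) (g c)) ac => // [ltac|ltca] _.
    by move: (sep _ _ _ ltac ltcb); rewrite acb.
  by move: (sep _ _ _ ltca ltab); rewrite avoiding_sym bac.
case: (ltngtP (g b) (g c)) bc => // [ltbc|ltcb] _; last first.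
  by move: (sep _ _ _ ltcb ltba); rewrite avoiding_sym abc.
case: (ltngtP (g a) (g c)) ac => // [ltac|ltca] _.
  by move: (sep _ _ _ ltba ltac); rewrite bac.
by move: (sep _ _ _ ltbc ltca); rewrite avoiding_sym acb.
Qed.

(** A simple path from [x] to a different [y] off [i] would close up to a cycle through [i]. *)
Lemma acyclic_neighbors_avoiding i x y : acyclic G -> G i x -> G i y ->
  connect (avoiding G [set i]) x y -> x = y.
Proof.
move=> acyG Gix Giy /connectP[p0]; case/shortenP=> p /avoiding_path[pathp pi].
move=> uniqp _ def_y; apply/eqP; apply: contraT => nxy.
have p0n : p != [::] by apply: contra_neq nxy => p0n; rewrite def_y p0n.
suff /acyG : ucycle G (i :: x :: p) by case: p p0n {pathp uniqp def_y pi}.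
rewrite /ucycle /ucycleb cons_uniq uniqp andbT; apply/andP; split.
  by rewrite /= rcons_path Gix pathp -def_y sg_sym.
rewrite inE negb_or; apply/andP; split.
  by apply: contraTneq Gix => <-; rewrite sg_irr.
by apply/negP => /pi; rewrite inE eqxx.
Qed.

(** Take simple paths from [i] to [b] off [c] and from [i] to [c] off [b]. As [b] and [c] are joined
    off [i], acyclicity makes both start with the same neighbour of [i]. That branch has no
    high-degree vertex, so the walk to [b] must follow the path to [c], which then contains [b]. *)
Lemma generalized_star_no_tripod i b c :
  generalized_star_with_center G i -> ~~ tripod G i b c.
Proof.
case=> -[_ acyG] highG; have lowG x : x != i -> ~~ high_degree G x.
  by move=> xi; move/setP/(_ x): highG; rewrite !inE (negbTE xi) => ->.
apply/negP => /and4P[/and3P[ib ic bc] cbi ibc icb].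
have branch u w : i != u -> connect (avoiding G [set w]) i u ->
    exists x s, [/\ G i x, path G x s, uniq (i :: x :: s),
                    last x s = u & {in x :: s, forall y, y != w}].
  move=> iu /connectP[p0]; case/shortenP=> p /avoiding_path[pathp pw] uniqp _ def_u.
  case: p pathp pw uniqp def_u => [|x s] pathp pw uniqp def_u.
    by rewrite def_u eqxx in iu.
  exists x, s; split=> //; first by case/andP: pathp.
    by case/andP: pathp.
  by move=> y /pw; rewrite inE.
have branch_avoids x s y : uniq (i :: x :: s) -> y \in x :: s -> y != i.
  by case/andP=> ni _ ys; apply: contraNneq ni => <-.
have branch_connect x s : path G x s -> uniq (i :: x :: s) ->
    connect (avoiding G [set i]) x (last x s).
  move=> paths us; apply/connectP; exists s => //; apply: path_avoiding => //.
  by move=> y /(branch_avoids _ _ _ us); rewrite inE.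
have [x [s [Gix paths us lasts sc]]] := branch b c ib icb.
have [y [t [Giy patht ut lastt tb]]] := branch c b ic ibc.
have Exy : x = y.
  apply: (acyclic_neighbors_avoiding acyG Gix Giy).
  apply: connect_trans (branch_connect _ _ paths us) _; rewrite lasts.
  by apply: connect_trans cbi _; rewrite -lastt avoiding_sym branch_connect.
suff : b \in y :: t by move/tb; rewrite eqxx.
have xb : connect (avoiding G [set i; c]) x b.
  rewrite -lasts; apply/connectP; exists s => //; apply: path_avoiding => // z zs.
  by rewrite !inE negb_or (branch_avoids _ _ _ us zs) sc.
apply: (connect_preserved (P := fun u => u \in y :: t) _ xb); last first.
  by rewrite Exy mem_head.
(* [u] is neither [i] nor the end [c], hence an inner vertex of [i :: y :: t], and all its
   neighbours lie on that path. *)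
move=> u w; rewrite avoidingE !in_set2 !negb_or.
case/and3P=> Guw /andP[ui uc] /andP[wi _] ut'.
suff : w \in i :: y :: t by rewrite inE (negbTE wi).
have sortt : sorted G (i :: y :: t) by rewrite /= Giy.
have lastt' : last i (y :: t) = c by [].
case/splitPr: ut' sortt ut lastt' => p1 p2.
case: p2 => [|d p2]; first by rewrite last_cat /= => _ _ uc'; rewrite uc' eqxx in uc.
rewrite -cat_cons lastI cat_rcons => sortt uniqt _.
exact: inner_neighbors sortt uniqt (lowG _ ui) Guw.
Qed.

End PathCharacterization.

(** * Minors *)

Lemma connect_image (T T' : finType) (e : rel T) (e' : rel T') (f : T -> T') x y :
  (forall u v, e u v -> connect e' (f u) (f v)) ->
  connect e x y -> connect e' (f x) (f y).
Proof.
move=> fe xy; apply: (connect_preserved (P := fun z => connect e' (f x) (f z)) _ xy).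
  by move=> u v /fe fuv xu; apply: connect_trans fuv.
exact: connect0.
Qed.

Lemma avoidingS n (G : sgraph n) (S S' : {set 'I_n}) x y :
  S \subset S' -> connect (avoiding G S') x y -> connect (avoiding G S) x y.
Proof.
move=> /subsetP sSS'; apply: connect_sub => u v /and3P[Guv uS vS]; apply: connect1.
by rewrite avoidingE Guv (contra (sSS' u)) // (contra (sSS' v)).
Qed.

(** * Lifting tripods along quotient maps *)

Section Quotients.

Variables (m n : nat) (H : sgraph m) (K : sgraph n) (f : 'I_m -> 'I_n).

Section Lift.

Hypothesis fiber : forall x y, f x = f y -> x = y \/ H x y.
Hypothesis edge : forall a b, K a b -> exists x y, [/\ f x = a, f y = b & H x y].

(** Distinct vertices of a fibre are adjacent, so a walk in [K] lifts edge by edge, with at most one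
    step inside a fibre between consecutive lifts. Bijections and edge contractions are both of this
    kind. *)
Lemma connect_lift (S : {set 'I_n}) x y : f x \notin S ->
  connect (avoiding K S) (f x) (f y) -> connect (avoiding H (f @^-1: S)) x y.
Proof.
have fiberS u v : f u \notin S -> f u = f v -> connect (avoiding H (f @^-1: S)) u v.
  move=> uS fuv; have [->|Huv] := fiber fuv; first exact: connect0.
  by apply: connect1; rewrite avoidingE Huv !inE -fuv uS.
move=> xS /connectP[p]; elim: p x xS => [|b p IHp] x xS /=.
  by move=> _ fxy; apply: fiberS.
case/andP=> /and3P[/edge[u [v [fu fv Huv]]] _ bS]; rewrite -fv => pathp lastp.
have vS : f v \notin S by rewrite fv.
apply: connect_trans (IHp v vS pathp lastp).
apply: connect_trans (fiberS x u xS (esym fu)) (connect1 _).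
by rewrite avoidingE Huv !inE fu xS.
Qed.

Lemma tripod_lift a b c : tripod K (f a) (f b) (f c) -> tripod H a b c.
Proof.
have neq x y : f x != f y -> x != y by apply: contraNneq => ->.
have lift x y z : f x != f z -> connect (avoiding K [set f z]) (f x) (f y) ->
    connect (avoiding H [set z]) x y.
  move=> xz /connect_lift; rewrite !inE => /(_ xz); apply: avoidingS.
  by rewrite sub1set !inE.
case/and4P=> /and3P[ab ac bc] Kbc Kac Kab; rewrite /tripod !neq //=.
by rewrite !lift // eq_sym.
Qed.

Lemma has_tripod_lift i : (forall a, a \in codom f) ->
  has_tripod K (f i) -> has_tripod H i.
Proof.
move=> surjf /has_tripodP[a [b]].
case/codomP: (surjf a) => x ->; case/codomP: (surjf b) => y -> /tripod_lift.
by move=> ixy; apply/has_tripodP; exists x, y.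
Qed.

End Lift.

Hypothesis contracts :
  forall a b, K a b = (a != b) && [exists x, exists y, [&& f x == a, f y == b & H x y]].

Lemma connect_contract (S : {set 'I_n}) x y :
  connect (avoiding H (f @^-1: S)) x y -> connect (avoiding K S) (f x) (f y).
Proof.
apply: connect_image => u v /and3P[Huv]; rewrite !inE => uS vS.
have [->|fuv] := eqVneq (f u) (f v); first exact: connect0.
apply: connect1; rewrite avoidingE uS vS contracts fuv /= andbT.
by apply/existsP; exists u; apply/existsP; exists v; rewrite !eqxx.
Qed.

End Quotients.

(** Relabelling, edge deletion and contraction are quotient maps and fall under [has_tripod_lift].
    For the deletion of an isolated vertex the map goes from [K] to [H], and connections are pushed
    forward along this embedding. *)
Lemma has_tripod_minor_step (H K : Defs.rgraph) : rooted_minor_step H K ->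
  has_tripod K (rg_root K) -> has_tripod H (rg_root H).
Proof.
case=> [f bijf fr KH|u v f Huv bijf fr KH|v f vr isov injf imf fr KH|u v f Huv surjf fib fr KH].
- rewrite -fr; have [g fK gK] := bijf; apply: has_tripod_lift => [x y /(can_inj fK)|a b|a].
  + by left.
  + by move=> Kab; exists (g a), (g b); rewrite !gK -KH !gK.
  + by rewrite -(gK a) codom_f.
- rewrite -fr; have [g fK gK] := bijf; apply: has_tripod_lift => [x y /(can_inj fK)|a b|a].
  + by left.
  + rewrite -{1}(gK a) -{1}(gK b) KH => /andP[Hab _].
    by exists (g a), (g b); rewrite !gK.
  + by rewrite -(gK a) codom_f.
- rewrite -fr => /has_tripodP[a [b /and4P[ne]]].
  set r := rg_root K in ne * => cab crb cra.
  apply/has_tripodP; exists (f a), (f b); rewrite /tripod !(inj_eq injf) ne /=.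
  have im x y z : connect (avoiding K [set z]) x y ->
      connect (avoiding H [set f z]) (f x) (f y).
    apply: connect_image => s t /and3P[]; rewrite !inE => Kst sz tz.
    by apply: connect1; rewrite avoidingE -KH Kst !inE !(inj_eq injf) sz.
  by rewrite !im.
- rewrite -fr; apply: has_tripod_lift => // [x y /eqP|a b].
    rewrite fib => /predU1P[->|/eqP E]; first by left.
    have [xE yE] : x \in [set u; v] /\ y \in [set u; v] by rewrite -E !inE !eqxx orbT.
    have [->|nxy] := eqVneq x y; [by left | right; move: nxy].
    by move: xE yE; rewrite !inE => /pred2P[]-> /pred2P[]->; rewrite ?eqxx // sg_sym.
  by rewrite KH => /andP[_ /existsP[x /existsP[y /and3P[/eqP fx /eqP fy Hxy]]]]; exists x, y.
Qed.

Lemma tripod_K3 : has_tripod K3_rooted (rg_root K3_rooted).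
Proof.
apply/has_tripodP; exists (inord 1), (inord 2).
have [E1 E2] : @inord 2 1 = 1 :> nat /\ @inord 2 2 = 2 :> nat by rewrite !inordK.
have adj x y z : x != y -> x != z -> y != z ->
    connect (avoiding K3_rooted [set z]) x y.
  by move=> xy xz yz; apply: connect1; rewrite avoidingE !inE xz yz !andbT.
by rewrite /tripod !adj -?val_eqE /= ?E1 ?E2.
Qed.

Lemma tripod_K13 : has_tripod K13_leaf (rg_root K13_leaf).
Proof.
apply/has_tripodP; exists (inord 1), (inord 2).
have [E1 E2] : @inord 3 1 = 1 :> nat /\ @inord 3 2 = 2 :> nat by rewrite !inordK.
have via x y z : x != ord0 -> y != ord0 -> z != ord0 -> x != z -> y != z ->
    connect (avoiding K13_leaf [set z]) x y.
  move=> x0 y0; rewrite eq_sym => z0 xz yz; apply: (@connect_trans _ _ ord0).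
    by apply: connect1; rewrite avoidingE !inE xz z0 /= /star_adj eqxx (negbTE x0).
  by apply: connect1; rewrite avoidingE !inE yz z0 /= /star_adj eqxx (negbTE y0).
by rewrite /tripod !via -?val_eqE /= ?E1 ?E2.
Qed.

Lemma has_tripod_minor (H K : Defs.rgraph) : rooted_minor K H ->
  has_tripod K (rg_root K) -> has_tripod H (rg_root H).
Proof.
by elim=> [? ? /has_tripod_minor_step|//|? ? ? _ IH1 _ IH2 /IH2/IH1].
Qed.

Lemma contraction_exists (H : Defs.rgraph) (u v : 'I_(rg_order H)) : H u v ->
  exists (K : Defs.rgraph) (f : 'I_(rg_order H) -> 'I_(rg_order K)),
    [/\ rg_order K = (rg_order H).-1, forall a, a \in codom f,
        forall x y, (f x == f y) = (x == y) || ([set x; y] == [set u; v]),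
        f (rg_root H) = rg_root K &
        forall a b, K a b =
          (a != b) && [exists x, exists y, [&& f x == a, f y == b & H x y]]].
Proof.
move: H u v => [n G r] /= u v Guv.
have nvu : v != u by apply: contraTneq Guv => ->; rewrite sg_irr.
have [u' def_u _] := unlift_some nvu.
(* The vertices of the contraction are those other than [v], renumbered by [unlift v]; the default
   value sends [v] to the new index [u'] of [u]. *)
pose f x := odflt u' (unlift v x).
pose adj : rel 'I_n.-1 := fun a b =>
  (a != b) && [exists x, exists y, [&& f x == a, f y == b & G x y]].
have adj_sym : symmetric adj.
  move=> a b; rewrite /adj eq_sym; congr (_ && _).
  by apply/existsP/existsP => -[x /existsP[y /and3P[fx fy Gxy]]];
    exists y; apply/existsP; exists x; rewrite fx fy sg_sym.
have adj_irr : irreflexive adj by move=> a; rewrite /adj eqxx.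
exists (RGraph (SGraph adj_sym adj_irr) (f r)), f; split=> //= [a|x y].
  by apply/codomP; exists (lift v a); rewrite /f liftK.
have f_lift a : f (lift v a) = a by rewrite /f liftK.
have fv : f v = u' by rewrite /f unlift_none.
case: (unliftP v x) => [a|] ->; case: (unliftP v y) => [b|] ->; rewrite ?f_lift ?fv.
- rewrite (inj_eq (@lift_inj _ v)); case: eqVneq => //= ab.
  apply/esym/eqP => /setP/(_ v).
  by rewrite !inE eqxx orbT !(negbTE (neq_lift _ _)).
- rewrite [_ == v]eq_sym (negbTE (neq_lift _ _)) def_u /=.
  apply/eqP/eqP => [->//|/setP/(_ (lift v u'))].
  by rewrite !inE eqxx [_ == v]eq_sym (negbTE (neq_lift _ _)) orbF (inj_eq (@lift_inj _ v)) => /eqP.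
- rewrite (negbTE (neq_lift _ _)) def_u /=.
  apply/eqP/eqP => [<-|/setP/(_ (lift v u'))]; first by rewrite setUC.
  by rewrite !inE eqxx [_ == v]eq_sym (negbTE (neq_lift _ _)) /= (inj_eq (@lift_inj _ v)) => /eqP.
- by rewrite !eqxx.
Qed.

Lemma cover3_K3_minor (H : Defs.rgraph) b c : let i := rg_root H in
  (forall x, [|| x == i, x == b | x == c]) -> i != b -> i != c -> b != c ->
  H i b -> H i c -> H b c -> rooted_minor K3_rooted H.
Proof.
set i := rg_root H => /= cover ib ic bc Hib Hic Hbc; apply: rt_step.
pose f x : 'I_3 := inord (if x == i then 0 else if x == b then 1 else 2).
pose g (k : 'I_3) := nth i [:: i; b; c] k.
have fK : cancel f g.
  move=> x; case/or3P: (cover x) => /eqP ->; rewrite /g /f.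
  - by rewrite eqxx inordK.
  - by rewrite eqxx eq_sym (negbTE ib) inordK.
  - by rewrite [c == i]eq_sym [c == b]eq_sym (negbTE ic) (negbTE bc) inordK.
have gK : cancel g f.
  case=> [[|[|[|k]]] ltk] //; apply: val_inj; rewrite /g /f /= ?eqxx.
  - by rewrite inordK.
  - by rewrite eq_sym (negbTE ib) inordK.
  - by rewrite [c == i]eq_sym [c == b]eq_sym (negbTE ic) (negbTE bc) inordK.
apply: (@RelabelStep H K3_rooted f); first by exists g.
  by apply: val_inj; rewrite /f eqxx /= inordK.
move=> x y; rewrite /= /complete_adj (inj_eq (can_inj fK)).
have [->|] := eqVneq x y; first by rewrite sg_irr.
case/or3P: (cover x) => /eqP ->; case/or3P: (cover y) => /eqP ->;
  by rewrite ?eqxx // => _; rewrite ?Hib ?Hic ?Hbc // sg_sym ?Hib ?Hic ?Hbc.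
Qed.

Lemma cover4_K13_minor (H : Defs.rgraph) b c u : let i := rg_root H in
  (forall x, [|| x == u, x == b, x == c | x == i]) ->
  i != b -> i != c -> b != c -> u \notin [:: i; b; c] ->
  H u i -> H u b -> H u c -> ~~ H i b -> ~~ H i c -> ~~ H b c ->
  rooted_minor K13_leaf H.
Proof.
set i := rg_root H => /= cover ib ic bc.
rewrite !inE !negb_or => /and3P[ui ub uc] Hui Hub Huc Hib Hic Hbc; apply: rt_step.
(* The labels are those of [K13_leaf]: the centre is 0 and the root is the last leaf, 3. *)
pose f x : 'I_4 :=
  inord (if x == u then 0 else if x == b then 1 else if x == c then 2 else 3).
pose g (k : 'I_4) := nth i [:: u; b; c; i] k.
have [bu cu] : b != u /\ c != u by rewrite !(eq_sym _ u).
have [iu cb] : i != u /\ c != b by rewrite (eq_sym i) (eq_sym c).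
have fK : cancel f g.
  move=> x; case/or4P: (cover x) => /eqP ->; rewrite /g /f ?eqxx.
  - by rewrite inordK.
  - by rewrite (negbTE bu) inordK.
  - by rewrite (negbTE cu) (negbTE cb) inordK.
  - by rewrite (negbTE iu) (negbTE ib) (negbTE ic) inordK.
have gK : cancel g f.
  case=> [[|[|[|[|k]]]] ltk] //; apply: val_inj; rewrite /g /f /= ?eqxx.
  - by rewrite inordK.
  - by rewrite (negbTE bu) inordK.
  - by rewrite (negbTE cu) (negbTE cb) inordK.
  - by rewrite (negbTE iu) (negbTE ib) (negbTE ic) inordK.
apply: (@RelabelStep H K13_leaf f); first by exists g.
  by apply: val_inj; rewrite /f (negbTE iu) (negbTE ib) (negbTE ic) /= inordK.
have f0 x : (f x == ord0) = (x == u).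
  have <- : f u = ord0 by apply: val_inj; rewrite /f eqxx /= inordK.
  exact: inj_eq (can_inj fK) _ _.
have indep : {in [:: b; c; i] &, forall x y, H x y = false}.
  move=> x y; rewrite !inE => /or3P[]/eqP-> /or3P[]/eqP->; rewrite ?sg_irr //;
  by apply/negbTE => //; rewrite sg_sym.
move=> x y; rewrite /= /star_adj !f0.
have uE w : w != u -> H u w /\ w \in [:: b; c; i].
  by case/or4P: (cover w) => /eqP->; rewrite ?eqxx // !inE eqxx ?orbT.
have [->|xu] := eqVneq x u; have [->|yu] := eqVneq y u => //=.
- by rewrite sg_irr.
- by have [-> _] := uE y yu.
- by rewrite sg_sym; have [-> _] := uE x xu.
- by rewrite indep //; [case: (uE x xu)|case: (uE y yu)].
Qed.

(** * Contractions that preserve a tripod *)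

Section ContractTripod.

Variables (H K : Defs.rgraph) (f : 'I_(rg_order H) -> 'I_(rg_order K)).
Variables u v : 'I_(rg_order H).
Hypothesis fib : forall x y, (f x == f y) = (x == y) || ([set x; y] == [set u; v]).
Hypothesis contracts :
  forall a b, K a b = (a != b) && [exists x, exists y, [&& f x == a, f y == b & H x y]].

Lemma fiber_singleton a : a != u -> a != v -> f @^-1: [set f a] = [set a].
Proof.
move=> au av; apply/setP=> x; rewrite !inE fib; case: eqVneq => //= xa.
by apply/eqP => /setP/(_ a); rewrite !inE eqxx orbT (negbTE au) (negbTE av).
Qed.

Lemma fiber_pair : f @^-1: [set f v] = [set v; u].
Proof.
apply/setP=> x; rewrite !inE fib; case: (eqVneq x v) => //= xv.
apply/eqP/eqP => [/setP/(_ x)|->//]; rewrite !inE eqxx (negbTE xv) !orbF.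
by move/esym/eqP.
Qed.

(** Deleting [f b] or [f c] amounts to deleting a single vertex of [H]. Only the fibre of [f a] can
    be larger: if [a = v], deleting [f a] removes [u] as well, and the extra hypothesis keeps [b]
    and [c] joined. *)
Lemma tripod_contract a b c : a != u -> b != u -> b != v -> c != u -> c != v ->
  (a == v) ==> connect (avoiding H [set v; u]) b c ->
  tripod H a b c -> tripod K (f a) (f b) (f c).
Proof.
move=> au bu bv cu cv avoid_uv /and4P[/and3P[ab ac bc] Hbc Hac Hab].
have f_neq x y : x != y -> y != u -> y != v -> f x != f y.
  move=> xy yu yv; apply: contra_neq xy => fxy; apply/eqP; rewrite -in_set1.
  by rewrite -(fiber_singleton yu yv) !inE fxy.
rewrite /tripod !f_neq //=; apply/and3P; split; apply: (connect_contract contracts).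
- have [av|av] := eqVneq a v; last by rewrite fiber_singleton.
  by rewrite av eqxx in avoid_uv *; rewrite fiber_pair.
- by rewrite fiber_singleton.
- by rewrite fiber_singleton.
Qed.

Lemma connected_contract : (forall a, a \in codom f) ->
  connected_graph H -> connected_graph K.
Proof.
move=> surjf connH a b; case/codomP: (surjf a) => x ->; case/codomP: (surjf b) => y ->.
apply: connect_image (connH x y) => s t Hst.
have [->|fst] := eqVneq (f s) (f t); first exact: connect0.
apply: connect1; rewrite contracts fst /=.
by apply/existsP; exists s; apply/existsP; exists t; rewrite !eqxx.
Qed.

End ContractTripod.

(* If no contraction preserves the tripod, the vertices outside it are pairwise
   non-adjacent and each of them is the only link between any two vertices of
   the tripod: there is at most one, and the graph is a triangle or a claw. *)
Lemma has_tripod_has_minor (H : Defs.rgraph) : connected_graph H ->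
  has_tripod H (rg_root H) ->
  rooted_minor K3_rooted H \/ rooted_minor K13_leaf H.
Proof.
have [m] := ubnP (rg_order H); elim: m H => // m IHm H leHm connH.
case/has_tripodP=> b [c]; set i := rg_root H => Ti; apply: contrapT => noP.
(* Otherwise the induction hypothesis applies to the contracted graph. The root may be any of [a],
   [d], [e]; rotating the tripod brings it to the front. *)
have no_contract (a d e u v : 'I_(rg_order H)) : tripod H a d e ->
    i \in [:: a; d; e] -> H u v ->
    u \notin [:: a; d; e] -> v \notin [:: d; e] ->
    ~~ ((a == v) ==> connect (avoiding H [set v; u]) d e).
  move=> T; rewrite !inE => iT Huv; rewrite !negb_or.
  rewrite (eq_sym u a) (eq_sym u d) (eq_sym u e) (eq_sym v d) (eq_sym v e).
  case/and3P=> au du eu /andP[dv ev]; apply/negP => cond; apply: noP.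
  have [K [f [ordK surjf fib froot contracts]]] := contraction_exists Huv.
  have TK := tripod_contract fib contracts au du dv eu ev cond T.
  have step : rooted_minor_step H K by apply: EdgeContractionStep Huv _ _ _ _.
  have := IHm K; case.
  - have : 0 < rg_order H by case: (rg_order H) (i) => // -[].
    by move: leHm; rewrite ordK; case: (rg_order H).
  - exact: connected_contract contracts surjf connH.
  - rewrite -froot; apply/has_tripodP; case/or3P: iT => /eqP E; rewrite -/i E.
    + by exists (f d), (f e).
    + by exists (f e), (f a); rewrite -tripod_rot.
    + by exists (f a), (f d); rewrite tripod_rot.
  - by move=> KK; left; apply: rt_trans (rt_step _ _ _ _ step) KK.
  - by move=> KK; right; apply: rt_trans (rt_step _ _ _ _ step) KK.
have cyc a d e : tripod H a d e -> tripod H d e a by rewrite tripod_rot.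
have Tb : tripod H b c i := cyc _ _ _ Ti.
have Tc : tripod H c i b := cyc _ _ _ Tb.
have perm_b : [:: b; c; i] =i [:: i; b; c] by move=> x; rewrite !inE; do !case: eqP.
have perm_c : [:: c; i; b] =i [:: i; b; c] by move=> x; rewrite !inE; do !case: eqP.
case/and4P: (Ti) => /and3P[ib ic bc] _ _ _.
have indep u v : u \notin [:: i; b; c] -> v \notin [:: i; b; c] -> H u v = false.
  move=> nu nv; apply/negP => Huv.
  have nvbc : v \notin [:: b; c] by apply: contra nv => vbc; rewrite inE vbc orbT.
  have := no_contract i b c u v Ti; rewrite mem_head => /(_ isT Huv nu nvbc).
  have : i != v by apply: contraNneq nv => <-; rewrite mem_head.
  by move=> /negbTE ->.
(* Merging [u] into the tripod vertex [a] can fail to preserve the tripod only if [a] and [u]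
   together separate [d] from [e]. *)
have sole a d e u : tripod H a d e -> [:: a; d; e] =i [:: i; b; c] ->
    u \notin [:: i; b; c] -> H u a -> ~~ connect (avoiding H [set a; u]) d e.
  move=> T permT nu Hua; have [/and3P[ad ae de] _ _ _] := and4P T.
  have := no_contract a d e u a T; rewrite !permT mem_head => /(_ isT Hua nu).
  rewrite !inE negb_or ad ae eqxx; exact.
have link a d e : tripod H a d e -> [:: a; d; e] =i [:: i; b; c] ->
    H d e \/ exists w, [/\ w \notin [:: i; b; c], H d w & H w e].
  move=> T permT; have [/and3P[ad ae de] Hde _ _] := and4P T.
  apply: contrapT => nolink; have nHde : ~~ H d e by apply/negP => ?; apply: nolink; left.
  (* [P] is [d] with its neighbours outside the tripod. Outside vertices are independent and [d],
     [e] are not adjacent, so an edge leaving [P] off [a] joins an outside vertex to [e], which is a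
     link. *)
  pose P x := (x == d) || ((x \notin [:: i; b; c]) && H d x).
  suff : P e by rewrite /P eq_sym (negbTE de) -permT !inE eqxx !orbT.
  apply: (connect_preserved (P := P) _ Hde); last by rewrite /P eqxx.
  move=> x y; rewrite avoidingE !inE => /and3P[Hxy xa ya] /orP[/eqP Ex|/andP[nx Hdx]].
    rewrite /P -permT !inE !negb_or ya; rewrite Ex in Hxy; rewrite Hxy.
    by case: eqVneq => //= yd; rewrite andbT; apply: contraNneq nHde => <-.
  have : y \in [:: a; d; e].
    by apply: contraTT Hxy; rewrite permT => ny; rewrite indep.
  rewrite !inE (negbTE ya) /= => /orP[yd|/eqP ye]; first by rewrite /P yd.
  by case: nolink; right; exists x; rewrite -ye.
(* By [sole], a link between [d] and [e] can be neither an edge nor an outside vertex other than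
   [u]. *)
have hub a d e u : tripod H a d e -> [:: a; d; e] =i [:: i; b; c] ->
    u \notin [:: i; b; c] -> H u a ->
    [/\ H u d, H u e, ~~ H d e &
        forall w, w \notin [:: i; b; c] -> H d w -> H w e -> w = u].
  move=> T permT nu Hua; have [/and3P[ad ae de] _ _ _] := and4P T.
  have nconn := sole a d e u T permT nu Hua.
  have [ud ue] : u != d /\ u != e.
    by move: nu; rewrite -permT !inE !negb_or => /and3P[].
  have nHde : ~~ H d e.
    apply: contra nconn => Hde; apply: connect1.
    by rewrite avoidingE Hde !inE !negb_or !(eq_sym _ a) ad ae !(eq_sym _ u) ud ue.
  have uniq_w w : w \notin [:: i; b; c] -> H d w -> H w e -> w = u.
    move=> nw Hdw Hwe; apply/eqP; apply: contraNT nconn => wu.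
    have wa : w != a by move: nw; rewrite -permT !inE !negb_or => /and3P[].
    apply: (@connect_trans _ _ w); apply: connect1;
      rewrite avoidingE ?Hdw ?Hwe !inE !negb_or wa wu;
      by rewrite !(eq_sym _ a) ?ad ?ae !(eq_sym _ u) ?ud ?ue.
  have [|[w [nw Hdw Hwe]]] := link a d e T permT; first by rewrite (negbTE nHde).
  by rewrite -{1 2}(uniq_w w) // sg_sym.
have perm_i : [:: i; b; c] =i [:: i; b; c] by [].
(* Connectivity gives an outside vertex a neighbour, which is in the tripod by independence; [hub]
   supplies the other two. *)
have full u : u \notin [:: i; b; c] -> [/\ H u i, H u b & H u c].
  move=> nu; have [t] : exists t, (t \in [:: i; b; c]) && H u t.
    have [p] := connectP (connH u i); case: p => [|t p] /=.
      by move=> _ Eu; rewrite Eu mem_head in nu.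
    case/andP=> Hut _ _; exists t; rewrite Hut andbT.
    by apply: contraTT Hut => nt; rewrite indep.
  rewrite !inE => /andP[/or3P[]/eqP-> Hut].
  - by have [] := hub _ _ _ _ Ti perm_i nu Hut.
  - by have [] := hub _ _ _ _ Tb perm_b nu Hut.
  - by have [] := hub _ _ _ _ Tc perm_c nu Hut.
have [/existsP[u nu]|nU] := boolP [exists u, u \notin [:: i; b; c]].
  have [Hui Hub Huc] := full u nu.
  have [_ _ nHbc uniq_u] := hub _ _ _ _ Ti perm_i nu Hui.
  have [_ _ nHci _] := hub _ _ _ _ Tb perm_b nu Hub.
  have [_ _ nHib _] := hub _ _ _ _ Tc perm_c nu Huc.
  apply: noP; right; apply: (@cover4_K13_minor H b c u) => // [x|].
    have [|nx] := boolP (x \in [:: i; b; c]).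
      by rewrite !inE => /or3P[]->; rewrite ?orbT.
    have [Hxi Hxb Hxc] := full x nx.
    by rewrite (uniq_u x) ?eqxx // sg_sym.
  by rewrite sg_sym.
have no_link a d e : tripod H a d e -> [:: a; d; e] =i [:: i; b; c] -> H d e.
  move=> T permT; have [//|[w [nw _ _]]] := link a d e T permT.
  by case/existsP: nU; exists w.
apply: noP; left; apply: (@cover3_K3_minor H b c) => //.
- move=> x; have : x \in [:: i; b; c]; last by rewrite !inE.
  by apply: contraNT nU => nx; apply/existsP; exists x.
- exact: no_link Tc perm_c.
- by rewrite sg_sym; apply: no_link Tb perm_b.
- exact: no_link Ti perm_i.
Qed.

(** * Null vectors *)

Section Deletion.

Local Open Scope ring_scope.

Variable F : fieldType.

Lemma mulmx_split_index m n p (A : 'M[F]_(m, n)) (B : 'M[F]_(n, p)) i :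
  A *m B = col i A *m row i B + col' i A *m row' i B.
Proof.
apply/matrixP => j k; rewrite !mxE (bigD1_ord i) //= big_ord1 !mxE.
by congr (_ + _); apply: eq_bigr => l _; rewrite !mxE.
Qed.

Lemma mxrank_row' m n (A : 'M[F]_(m, n)) i :
  (row i A <= row' i A)%MS -> \rank (row' i A) = \rank A.
Proof.
move=> sub; apply/eqP; rewrite eqn_leq; apply/andP; split; apply: mxrankS.
  apply/row_subP => k; have -> : row k (row' i A) = row (lift i k) A.
    by apply/rowP => j; rewrite !mxE.
  exact: row_sub.
apply/row_subP => k; case: (unliftP i k) => [l|] -> //.
have -> : row (lift i l) A = row l (row' i A) by apply/rowP => j; rewrite !mxE.
exact: row_sub.
Qed.

(** As [x 0 i] is invertible, the relation [x *m A = 0] expresses row [i] through the other rows. *)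
Lemma mxrank_row'_null m n (A : 'M[F]_(m, n)) (x : 'rV_m) i :
  x *m A = 0 -> x 0 i != 0 -> \rank (row' i A) = \rank A.
Proof.
rewrite (mulmx_split_index _ _ i) => xA xi; apply: mxrank_row'.
apply/submxP; exists (- (x 0 i)^-1 *: col' i x).
have -> : row i A = (x 0 i)^-1 *: (col i x *m row i A).
  apply/rowP => j; rewrite !mxE big_ord1 !mxE mulrA mulVf // mul1r.
  by [].
by move/eqP: xA; rewrite addr_eq0 => /eqP ->; rewrite -scalemxAl scalerN scaleNr.
Qed.

(** By symmetry [x] also makes column [i] redundant. It still annihilates the matrix without that
    column, so row [i] can be deleted next. *)
Lemma mxrank_del_null n (A : 'M[F]_n) (x : 'rV_n) i :
  A^T = A -> x *m A = 0 -> x 0 i != 0 -> \rank (row' i (col' i A)) = \rank A.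
Proof.
move=> symA xA xi.
have rank_col : \rank (col' i A) = \rank A.
  by rewrite -mxrank_tr tr_col' symA; apply: mxrank_row'_null xA xi.
rewrite -rank_col; apply: (mxrank_row'_null (x := x)) => //.
apply/rowP => j; move/rowP/(_ (lift i j)): xA; rewrite !mxE => xAj.
by rewrite -[RHS]xAj; apply: eq_bigr => k _; rewrite !mxE.
Qed.

End Deletion.

(** * From the nullity pair to a tripod *)

Section NullityPair.

Local Open Scope ring_scope.

Variable R : realType.

Lemma nullity_kermx n (A : 'M[R]_n) : nullity A = \rank (kermx A).
Proof. by rewrite /nullity mxrank_coker mxrank_ker. Qed.

(** If all null vectors vanished at [i], dropping this coordinate would embed a 2-dimensional kernel
    into a 1-dimensional one. For [y], take a null vector outside the span of [x] and subtract the
    multiple of [x] that clears its entry at [i]. *)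
Lemma nullity_pair_null_vectors n (A : 'M[R]_n) i :
  A^T = A -> nullity_pair A i = (2, 1)%N ->
  exists x y : 'rV_n, [/\ x *m A = 0, x 0 i != 0, y *m A = 0, y 0 i = 0 & y != 0].
Proof.
move=> symA [null2]; rewrite nullity_kermx in null2 *; rewrite nullity_kermx => null1.
have [x [xA xi]] : exists x : 'rV_n, x *m A = 0 /\ x 0 i != 0.
  apply: contrapT => none.
  have K0 k : kermx A k i = 0.
    apply/eqP; apply: contraT => nz; case: none; exists (row k (kermx A)).
    by rewrite mxE; split=> //; rewrite -row_mul mulmx_ker row0.
  have rankK : \rank (col' i (kermx A)) = 2%N.
    rewrite -[RHS]null2 -mxrank_tr tr_col' -[RHS]mxrank_tr; apply: mxrank_row'.
    have -> : row i (kermx A)^T = 0 by apply/rowP => k; rewrite [RHS]mxE 2!mxE K0.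
    exact: sub0mx.
  have: (\rank (col' i (kermx A)) <= \rank (kermx (del_row_col A i)))%N.
    apply: mxrankS; apply/sub_kermxP.
    have := mulmx_split_index (kermx A) (col' i A) i.
    have -> : col i (kermx A) = 0 by apply/colP => k; rewrite [RHS]mxE mxE K0.
    rewrite mul0mx add0r => <-; apply/matrixP => k j; rewrite mxE [RHS]mxE.
    have /matrixP/(_ k (lift i j)) := mulmx_ker A; rewrite mxE [RHS]mxE => KAj.
    by rewrite -[RHS]KAj; apply: eq_bigr => l _; rewrite [col' _ _ _ _]mxE.
  by rewrite rankK null1.
have [k nk] : exists k, ~~ (row k (kermx A) <= x)%MS.
  apply/row_subPn; apply: contraTN isT => /mxrankS; rewrite null2.
  by rewrite leqNgt (leq_ltn_trans (rank_leq_row x)).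
pose z := row k (kermx A); pose y := z - (z 0 i / x 0 i) *: x.
have zA : z *m A = 0 by rewrite -row_mul mulmx_ker row0.
exists x, y; split=> //.
- by rewrite mulmxBl zA -scalemxAl xA scaler0 subr0.
- by rewrite !mxE divfK // subrr.
- by apply: contraNneq nk => /eqP; rewrite subr_eq0 => /eqP E; rewrite -/z E scalemx_sub.
Qed.

Variables (n : nat) (G : sgraph n) (i : 'I_n) (A : 'M[R]_n).
Hypothesis GA : graph_matrix G A.

Lemma graph_matrix_eq0 x y : x != y -> ~~ G x y -> A x y = 0.
Proof. by case: GA => _ GAx xy; rewrite -GAx // negbK => /eqP. Qed.

Lemma graph_matrix_neq0 x y : G x y -> A x y != 0.
Proof.
move=> Gxy; case: GA => _ ->//; apply: contraTneq Gxy => ->.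
by rewrite sg_irr.
Qed.

(** Two consecutive zeros propagate: [y] has no neighbours besides [x] and [w], so the equation at
    [y] reduces to [z 0 w * A w y = 0]. *)
Lemma null_vector_path_zero (z : 'rV_n) x y s :
  z *m A = 0 -> (forall w, w != i -> ~~ high_degree G w) ->
  G x y -> path G y s -> uniq (x :: y :: s) -> i \notin y :: s ->
  z 0 x = 0 -> z 0 y = 0 -> z 0 (last y s) = 0.
Proof.
move=> zA lowG; elim: s x y => [|w s IHs] x y //= Gxy /andP[Gyw paths] uniqs ni zx zy.
case/andP: (uniqs) => nx uniqs'.
apply: (IHs y w) => //; first by apply: contra ni => iws; rewrite inE iws orbT.
have yi : y != i by apply: contraNneq ni => <-; rewrite mem_head.
have xw : x != w by move: nx; rewrite !inE !negb_or => /and3P[].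
have /rowP/(_ y) := zA; rewrite !mxE (bigD1 w) //= big1 ?addr0 => [/eqP|v vw].
  by rewrite mulf_eq0 (negbTE (graph_matrix_neq0 _)) ?orbF 1?sg_sym // => /eqP.
have [->|vy] := eqVneq v y; first by rewrite zy mul0r.
have [Gvy|nGvy] := boolP (G v y); last by rewrite graph_matrix_eq0 // mulr0.
rewrite sg_sym in Gvy; rewrite sg_sym in Gxy.
have := low_degree_neighbors (lowG y yi) Gxy Gyw xw Gvy.
by rewrite (negbTE vw) orbF => /eqP ->; rewrite zx mul0r.
Qed.

Lemma nullity_pair_tripod : connected_graph G -> nullity_pair A i = (2, 1)%N ->
  has_tripod G i.
Proof.
move=> connG null21; have [symA _] := GA.
have [x [y [xA xi yA yi y0]]] := nullity_pair_null_vectors symA null21.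
apply: contraT => noT.
have lowG w : w != i -> ~~ high_degree G w.
  by move=> wi; apply: contra noT; apply: high_degree_tripod wi.
have unique_nbr u w : G i u -> G i w -> connect (avoiding G [set i]) u w -> u = w.
  move=> Giu Giw uw; apply/eqP; apply: contraNT noT => nuw.
  have [iu iw] : i != u /\ i != w.
    by split; [apply: contraTneq Giu | apply: contraTneq Giw] => <-; rewrite sg_irr.
  apply/has_tripodP; exists u, w; rewrite /tripod iu iw nuw uw /=.
  apply/andP; split; apply: connect1; rewrite avoidingE !inE ?Giu ?Giw.
    by rewrite iu eq_sym.
  by rewrite iw.
have [v yv] : exists v, y 0 v != 0.
  by apply/existsP; rewrite -negb_forall; apply: contra y0 => /forallP y_0;
    apply/eqP/rowP => v; rewrite mxE; apply/eqP/y_0.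
have vi : v != i by apply: contraNneq yv => ->; rewrite yi.
pose C w := connect (avoiding G [set i]) v w.
have Ci w : C w -> w != i.
  move=> Cw; apply: (connect_preserved (P := fun u => u != i) _ Cw vi) => a b.
  by rewrite avoidingE !inE => /and3P[_ _ bi].
have Cstep a b : C a -> G a b -> b != i -> C b.
  move=> Ca Gab bi; apply: (connect_trans Ca); apply: connect1.
  by rewrite avoidingE Gab !inE bi andbT (Ci a Ca).
pose z : 'rV[R]_n := \row_w (if C w then y 0 w else 0).
(* For [w] in [C], every neighbour of [w] outside [C] is the root, where [y] vanishes, so the
   equation of [y] carries over. A non-root vertex outside [C] has no neighbour in [C]. *)
have zA_off w : w != i -> (z *m A) 0 w = 0.
  move=> wi; rewrite mxE; have [Cw|nCw] := boolP (C w).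
    have /rowP/(_ w) := yA; rewrite !mxE => yAw; rewrite -[RHS]yAw.
    apply: eq_bigr => u _; rewrite mxE.
    case: ifPn => // nCu; have [->|ui] := eqVneq u i; first by rewrite yi.
    rewrite mul0r graph_matrix_eq0 ?mulr0 //.
      by apply: contraNneq nCu => ->.
    by apply: contra nCu => Guw; apply: (Cstep w) => //; rewrite sg_sym.
  rewrite big1 // => u _; rewrite mxE; case: ifPn => Cu; last by rewrite mul0r.
  rewrite graph_matrix_eq0 ?mulr0 //; first by apply: contraNneq nCw => <-.
  by apply: contra nCw => Guw; apply: Cstep Guw wi.
(* Pairing [z *m A], supported at the root, with the null vector [x]. *)
have zA : z *m A = 0.
  apply/rowP => w; rewrite [RHS]mxE; have [->|] := eqVneq w i; last exact: zA_off.
  have : (z *m A) *m x^T = 0 by rewrite -mulmxA -[A]symA -trmx_mul xA trmx0 mulmx0.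
  move/rowP/(_ 0); rewrite mxE [RHS]mxE (bigD1 i) //= big1 => [|u ui];
    last by rewrite zA_off ?mul0r.
  by rewrite addr0 [x^T _ _]mxE => /eqP; rewrite mulf_eq0 (negbTE xi) orbF => /eqP.
have zv : z 0 v = y 0 v by rewrite mxE /C connect0.
suff : z 0 v = 0 by rewrite zv => /eqP; rewrite (negbTE yv).
have zi : z 0 i = 0 by rewrite mxE; case: ifP => // _; rewrite yi.
have [p0] := connectP (connG i v); case/shortenP=> p pathp uniqp _ def_v.
case: p pathp uniqp def_v => [|u s] /= pathp uniqp def_v.
  by rewrite def_v eqxx in vi.
case/andP: pathp => Giu paths; case/andP: (uniqp) => niu _.
rewrite def_v; apply: (@null_vector_path_zero z i u s) => //.
have Cu : C u.
  rewrite /C avoiding_sym def_v; apply/connectP; exists s => //.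
  apply: path_avoiding => // w ws; rewrite inE.
  by apply: contraNneq niu => <-.
(* By [unique_nbr], [u] is the only neighbour of [i] in [C], so the equation at [i] leaves the
   single term [z 0 u * A u i]. *)
have /rowP/(_ i) := zA; rewrite !mxE (bigD1 u) //= big1 ?addr0 => [/eqP|w wu].
  by rewrite mulf_eq0 (negbTE (graph_matrix_neq0 _)) ?orbF 1?sg_sym // mxE => /eqP.
rewrite mxE; case: ifPn => Cw; last by rewrite mul0r.
rewrite graph_matrix_eq0 ?mulr0 ?Ci //; apply: contraNN wu => Gwi.
rewrite sg_sym in Gwi; rewrite (unique_nbr u w) // avoiding_sym.
by apply: connect_trans Cu; rewrite avoiding_sym.
Qed.

End NullityPair.

(** * Matrices from tripods *)

Section Harmonic.

Local Open Scope ring_scope.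

Variables (R : realType) (n : nat) (G : sgraph n) (W : {set 'I_n}).
Implicit Types (x : 'cV[R]_n) (u v a b : 'I_n).

Definition nbr_sum x u : R := \sum_v (G u v)%:R * x v 0.

Definition schrodinger (d : 'I_n -> R) : 'M[R]_n :=
  \matrix_(u, v) ((u == v)%:R * d u - (G u v)%:R).

Lemma schrodingerE d x u : (schrodinger d *m x) u 0 = d u * x u 0 - nbr_sum x u.
Proof.
rewrite mxE; under eq_bigr => v _ do rewrite mxE mulrBl.
rewrite sumrB (bigD1 u) //= big1 => [|v vu]; first by rewrite eqxx mul1r addr0.
by rewrite eq_sym (negbTE vu) !mul0r.
Qed.

Lemma schrodinger_tr d : (schrodinger d)^T = schrodinger d.
Proof.
apply/matrixP => u v; rewrite !mxE (sg_sym G); congr (_ - _).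
by rewrite eq_sym; case: eqVneq => [->|]; rewrite ?mul0r.
Qed.

Lemma schrodinger_graph d : graph_matrix G (schrodinger d).
Proof.
split=> [|u v uv]; first exact: schrodinger_tr.
by rewrite mxE (negbTE uv) mul0r sub0r oppr_eq0; case: (G u v); rewrite ?oner_eq0 ?eqxx.
Qed.

(** One more than the degree, which makes the rows outside [W] strictly diagonally dominant. *)
Definition potential u : R := 1 + \sum_v (G u v)%:R.

(** The system of a boundary value problem: rows in [W] prescribe values, the other rows are those
    of [schrodinger] with diagonal [potential]. *)
Definition dirichlet : 'M[R]_n :=
  \matrix_(u, v) if u \in W then (u == v)%:R
                 else (u == v)%:R * potential u - (G u v)%:R.

Lemma dirichletE x u :
  (dirichlet *m x) u 0 = if u \in W then x u 0 else potential u * x u 0 - nbr_sum x u.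
Proof.
rewrite mxE; under eq_bigr => v _ do rewrite mxE; case: ifP => _; last first.
  by rewrite -schrodingerE mxE; apply: eq_bigr => v _; rewrite mxE.
rewrite (bigD1 u) //= big1 => [|v vu]; first by rewrite eqxx mul1r addr0.
by rewrite eq_sym (negbTE vu) !mul0r.
Qed.

(* At a minimum outside [W], [potential u * x u 0 - nbr_sum x u <= x u 0]. *)
Lemma dirichlet_ge0 x : (forall u, 0 <= (dirichlet *m x) u 0) -> forall u, 0 <= x u 0.
Proof.
move=> ge0 u; case: (@arg_minP _ _ _ u xpredT (fun v => x v 0) isT) => m _ min_m.
apply: le_trans (min_m u isT); have := ge0 m; rewrite dirichletE; case: ifP => // _.
move/le_trans; apply; rewrite /potential mulrDl mul1r -addrA gerDl subr_le0.
rewrite mulr_suml; apply: ler_sum => v _; apply: ler_wpM2l; first exact: ler0n.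
exact: min_m.
Qed.

Lemma dirichlet_inj x : dirichlet *m x = 0 -> x = 0.
Proof.
move=> Dx; apply/colP => u; rewrite [RHS]mxE; apply/eqP; rewrite eq_le.
rewrite -oppr_ge0; apply/andP; split.
  have := @dirichlet_ge0 (- x); rewrite mulmxN Dx oppr0 => /(_ _ u); rewrite !mxE; apply.
  by move=> v; rewrite mxE.
by apply: dirichlet_ge0 => v; rewrite Dx mxE.
Qed.

Lemma dirichlet_unit : dirichlet \in unitmx.
Proof.
rewrite -unitmx_tr -row_free_unit; apply: inj_row_free => v vD.
apply: trmx_inj; rewrite trmx0; apply: dirichlet_inj.
by rewrite -[dirichlet]trmxK -trmx_mul vD trmx0.
Qed.

(** For [a] in [W], the solution with boundary value 1 at [a] and 0 on the rest of [W]. *)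
Definition harmonic a : 'cV[R]_n := invmx dirichlet *m delta_mx a 0.

Lemma dirichlet_harmonic a : dirichlet *m harmonic a = delta_mx a 0.
Proof. by rewrite mulmxA mulmxV ?dirichlet_unit // mul1mx. Qed.

Lemma harmonic_in a u : u \in W -> harmonic a u 0 = (u == a)%:R.
Proof.
by move=> uW; have := dirichletE (harmonic a) u; rewrite uW dirichlet_harmonic mxE andbT.
Qed.

Lemma harmonic_off a u : a \in W -> u \notin W ->
  potential u * harmonic a u 0 = nbr_sum (harmonic a) u.
Proof.
move=> aW uW; have /negbTE ua : u != a by apply: contraNneq uW => ->.
have := dirichletE (harmonic a) u.
rewrite (negbTE uW) dirichlet_harmonic mxE ua => /esym/eqP.
by rewrite subr_eq0 => /eqP.
Qed.

Lemma harmonic_ge0 a u : 0 <= harmonic a u 0.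
Proof. by apply: dirichlet_ge0 => v; rewrite dirichlet_harmonic mxE ler0n. Qed.

Lemma nbr_sum_ge0 x u : (forall v, 0 <= x v 0) -> 0 <= nbr_sum x u.
Proof. by move=> x0; apply: sumr_ge0 => v _; rewrite mulr_ge0 ?ler0n. Qed.

Lemma nbr_sum_eq0 x u v : (forall w, 0 <= x w 0) -> nbr_sum x u = 0 -> G u v -> x v 0 = 0.
Proof.
move=> x0 sum0 Guv; have := sum0; rewrite /nbr_sum => /eqP; rewrite psumr_eq0.
  by move/allP/(_ v (mem_index_enum _)); rewrite Guv mul1r => /eqP.
by move=> w _; rewrite mulr_ge0 ?ler0n.
Qed.

(** If the sum were zero, the nonnegative [harmonic a] would vanish at all neighbours of [b]. A zero
    outside [W] also forces zeros at all neighbours, so zeros would spread along the walk up to [a],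
    where the value is 1. *)
Lemma nbr_sum_harmonic_gt0 a b : a \in W -> b \in W -> a != b ->
  connect (avoiding G (W :\ a :\ b)) b a -> 0 < nbr_sum (harmonic a) b.
Proof.
move=> aW bW ab ba; rewrite lt_neqAle nbr_sum_ge0 ?andbT; last exact: harmonic_ge0.
apply/eqP => /esym sum0.
suff: harmonic a a 0 == 0 by rewrite harmonic_in // eqxx oner_eq0.
apply: (connect_preserved (P := fun v => harmonic a v 0 == 0) _ ba); last first.
  by rewrite harmonic_in // [b == a]eq_sym (negbTE ab).
move=> u v /and3P[Guv uW vW] /eqP hu; apply/eqP.
apply: (@nbr_sum_eq0 _ u) => //; first exact: harmonic_ge0.
have [->//|ub] := eqVneq u b.
have ua : u != a.
  by apply/eqP => ua; move: hu; rewrite ua harmonic_in // eqxx => /eqP; rewrite oner_eq0.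
by rewrite -harmonic_off ?hu ?mulr0 //; move: uW; rewrite !inE ub ua.
Qed.

(** Symmetry of the Schur complement. [L *m harmonic s] is supported on [W], where [harmonic t] is
    the indicator of [t], so both sides are, up to sign, values of the symmetric form of [L]. *)
Lemma nbr_sum_harmonicC a b : a \in W -> b \in W ->
  nbr_sum (harmonic a) b = nbr_sum (harmonic b) a.
Proof.
pose L := schrodinger (fun u => if u \in W then 0 else potential u).
have pairing s t : s \in W -> t \in W ->
    ((harmonic t)^T *m (L *m harmonic s)) 0 0 = - nbr_sum (harmonic s) t.
  move=> sW tW; rewrite mxE (bigD1 t) //= big1 => [|u ut].
    by rewrite [_^T _ _]mxE harmonic_in // eqxx mul1r addr0 schrodingerE tW mul0r sub0r.
  rewrite [_^T _ _]mxE schrodingerE; case: ifPn => uW.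
    by rewrite harmonic_in // (negbTE ut) mul0r.
  by rewrite harmonic_off // subrr mulr0.
move=> aW bW; apply: oppr_inj; rewrite -!pairing //.
have -> : (harmonic a)^T *m (L *m harmonic b) = ((harmonic b)^T *m (L *m harmonic a))^T.
  by rewrite [RHS]trmx_mul trmxK [(L *m _)^T]trmx_mul schrodinger_tr mulmxA.
by rewrite [RHS]mxE.
Qed.

(** Both sides solve the same boundary value problem, and [dirichlet_inj] gives uniqueness. *)
Lemma dirichlet_expand x : (forall u, u \notin W -> potential u * x u 0 = nbr_sum x u) ->
  x = \sum_(a in W) x a 0 *: harmonic a.
Proof.
move=> xW; apply/eqP; rewrite -subr_eq0; apply/eqP; apply: dirichlet_inj.
rewrite mulmxBr mulmx_sumr; apply/colP => u; rewrite mxE dirichletE.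
rewrite [X in _ + X]mxE summxE [RHS]mxE.
have -> : \sum_(a in W) (dirichlet *m (x a 0 *: harmonic a)) u 0 = \sum_(a in W) x a 0 * (u == a)%:R.
  by apply: eq_bigr => a _; rewrite -scalemxAr dirichlet_harmonic !mxE andbT.
case: ifPn => uW.
  rewrite (bigD1 u) //= eqxx mulr1 big1 ?addr0 ?subrr // => a /andP[_ au].
  by rewrite eq_sym (negbTE au) mulr0.
rewrite xW // subrr big1 ?subr0 // => a aW.
by case: eqVneq => [ua|]; rewrite ?mulr0 //; rewrite ua aW in uW.
Qed.

Lemma nbr_sumD x y u : nbr_sum (x + y) u = nbr_sum x u + nbr_sum y u.
Proof. by rewrite -big_split; apply: eq_bigr => v _; rewrite mxE mulrDr. Qed.

Lemma nbr_sumZ k x u : nbr_sum (k *: x) u = k * nbr_sum x u.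
Proof. by rewrite mulr_sumr; apply: eq_bigr => v _; rewrite mxE mulrCA. Qed.

End Harmonic.

(** * Realising the nullity pair with the SNIP *)

Section TripodMatrix.

Local Open Scope ring_scope.

Variables (R : realType) (n : nat) (G : sgraph n).

(* The three free diagonal entries complete the Schur complement onto the
   tripod, whose off-diagonal entries are nonzero, to a matrix of rank one. *)
Lemma tripod_matrix i b c : tripod G i b c ->
  exists (A : 'M[R]_n) (h : 'I_n -> 'cV[R]_n) (pi pb pc : R),
    [/\ graph_matrix G A, [/\ pi != 0, pb != 0 & pc != 0],
        forall a u, u \in [set i; b; c] -> h a u 0 = (u == a)%:R &
        forall x : 'cV_n, A *m x = 0 <->
          x = x i 0 *: h i + x b 0 *: h b + x c 0 *: h c /\
          pi * x i 0 + pb * x b 0 + pc * x c 0 = 0].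
Proof.
case/and4P=> /and3P[ib ic bc] cbc cic cib.
pose W := [set i; b; c]; pose h := harmonic R G W.
have [iW bW cW] : [/\ i \in W, b \in W & c \in W] by rewrite !inE !eqxx !orbT.
have [bi ci cb] : [/\ b != i, c != i & c != b] by rewrite !(eq_sym _ i) (eq_sym c).
have sub_third s t w : W = [set s; t; w] -> W :\ s :\ t \subset [set w].
  by move=> ->; apply/subsetP => u; rewrite !inE; do 2!case: eqP.
have gt0 s t w : s != t -> W = [set s; t; w] -> connect (avoiding G [set w]) t s ->
    0 < nbr_sum G (h s) t.
  move=> st EW ts; apply: nbr_sum_harmonic_gt0; rewrite ?EW ?inE ?eqxx ?orbT // -EW.
  exact: avoidingS (sub_third _ _ _ EW) ts.
(* Up to sign, these are the off-diagonal entries of the Schur complement onto the tripod. *)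
pose e1 := nbr_sum G (h b) i; pose e2 := nbr_sum G (h c) i; pose e3 := nbr_sum G (h c) b.
have e1_gt0 : 0 < e1.
  by apply: gt0 cib => //; apply/setP=> u; rewrite !inE; do !case: eqP.
have e2_gt0 : 0 < e2.
  by apply: gt0 cic => //; apply/setP=> u; rewrite !inE; do !case: eqP.
have e3_gt0 : 0 < e3.
  by apply: gt0 cbc => //; apply/setP=> u; rewrite !inE; do !case: eqP.
have E1 : nbr_sum G (h i) b = e1 by rewrite /h nbr_sum_harmonicC.
have E2 : nbr_sum G (h i) c = e2 by rewrite /h nbr_sum_harmonicC.
have E3 : nbr_sum G (h b) c = e3 by rewrite /h nbr_sum_harmonicC.
(* For the column [w] with entries [e1 * e2], [e1 * e3], [e2 * e3], these values turn the Schur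
   complement into [- w w^T / (e1 * e2 * e3)]. *)
pose d u : R := if u == i then nbr_sum G (h i) i - e1 * e2 / e3
  else if u == b then nbr_sum G (h b) b - e1 * e3 / e2
  else if u == c then nbr_sum G (h c) c - e2 * e3 / e1
  else potential R G u.
have di : d i = nbr_sum G (h i) i - e1 * e2 / e3 by rewrite /d eqxx.
have db : d b = nbr_sum G (h b) b - e1 * e3 / e2 by rewrite /d (negbTE bi) eqxx.
have dc : d c = nbr_sum G (h c) c - e2 * e3 / e1.
  by rewrite /d (negbTE ci) (negbTE cb) eqxx.
have dW u : u \notin W -> d u = potential R G u.
  by rewrite !inE !negb_or /d => /andP[/andP[/negbTE-> /negbTE->] /negbTE->].
exists (schrodinger G d), h, (e1 * e2), (e1 * e3), (e2 * e3).
have hW a u : u \in W -> h a u 0 = (u == a)%:R by apply: harmonic_in.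
have nz : [/\ e1 != 0, e2 != 0 & e3 != 0] by rewrite !gt_eqF.
have [e10 e20 e30] := nz.
split; first exact: schrodinger_graph.
- by rewrite !mulf_eq0 !negb_or e10 e20 e30.
- exact: hW.
move=> x; set y := x i 0 *: h i + x b 0 *: h b + x c 0 *: h c.
set p := e1 * e2 * x i 0 + _ + _.
have sumW (F : 'I_n -> 'cV[R]_n) : \sum_(a in W) F a = F i + F b + F c.
  rewrite /W -setUA big_setU1 ?inE ?negb_or ?ib //= big_setU1 ?inE //= big_set1.
  by rewrite addrA.
have ny u : nbr_sum G y u = x i 0 * nbr_sum G (h i) u + x b 0 * nbr_sum G (h b) u
    + x c 0 * nbr_sum G (h c) u.
  by rewrite /y !nbr_sumD !nbr_sumZ.
have yE u : y u 0 = x i 0 * h i u 0 + x b 0 * h b u 0 + x c 0 * h c u 0.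
  by rewrite /y; move: (h i) (h b) (h c) => hi hb hc; rewrite !mxE.
have yi : y i 0 = x i 0.
  by rewrite yE !hW // eqxx (negbTE ib) (negbTE ic) !mulr0 !addr0 mulr1.
have yb : y b 0 = x b 0.
  by rewrite yE !hW // eqxx (negbTE bi) (negbTE bc) !mulr0 !addr0 mulr1 add0r.
have yc : y c 0 = x c 0.
  by rewrite yE !hW // eqxx (negbTE ci) (negbTE cb) !mulr0 !add0r mulr1.
have Ayi : (schrodinger G d *m y) i 0 = - (p / e3).
  by rewrite schrodingerE yi ny di -/e1 -/e2 /p; field.
have Ayb : (schrodinger G d *m y) b 0 = - (p / e2).
  by rewrite schrodingerE yb ny db E1 -/e3 /p; field.
have Ayc : (schrodinger G d *m y) c 0 = - (p / e1).
  by rewrite schrodingerE yc ny dc E2 E3 /p; field.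
(* The equations outside the tripod determine [x] from its values on it; the equation at [i] then
   gives the linear relation. *)
split=> [Ax|[-> p0]].
  have Exy : x = y.
    rewrite /y -(sumW (fun a => x a 0 *: h a)); apply: dirichlet_expand => u uW.
    move/colP/(_ u): Ax; rewrite schrodingerE dW // mxE => /eqP.
    by rewrite subr_eq0 => /eqP.
  split=> //; move: Ayi; rewrite -Exy Ax mxE => /esym/eqP.
  by rewrite oppr_eq0 mulf_eq0 invr_eq0 (negbTE e30) orbF => /eqP.
apply/colP => u; rewrite [RHS]mxE.
have [->|ui] := eqVneq u i; first by rewrite Ayi p0 mul0r oppr0.
have [->|ub] := eqVneq u b; first by rewrite Ayb p0 mul0r oppr0.
have [->|uc] := eqVneq u c; first by rewrite Ayc p0 mul0r oppr0.
have uW : u \notin W by rewrite !inE !negb_or ui ub uc.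
by rewrite schrodingerE dW // ny yE -!harmonic_off //; ring.
Qed.

Lemma tripod_allows_SNIP i : has_tripod G i -> allows_SNIP R G i 2 1.
Proof.
case/has_tripodP=> b [c Ti].
have [A [h [pi [pb [pc [GA [pi0 pb0 pc0] hW kerA]]]]]] := tripod_matrix Ti.
have [symA _] := GA; case/and4P: Ti => /and3P[ib ic bc] _ _ _.
have [iW bW cW] : [/\ i \in [set i; b; c], b \in [set i; b; c] & c \in [set i; b; c]].
  by rewrite !inE !eqxx !orbT.
have [bi ci cb] : [/\ b != i, c != i & c != b] by rewrite !(eq_sym _ i) (eq_sym c).
have kerA_tr (v : 'rV_n) : v *m A = 0 <-> A *m v^T = 0.
  split=> vA; first by rewrite -[A]symA -trmx_mul vA trmx0.
  by apply: trmx_inj; rewrite trmx_mul symA vA trmx0.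
(* On the tripod, [k1] and [k2] restrict to [(pb, - pi, 0)] and [(pc, 0, - pi)], a basis of the
   plane cut out by the linear relation. *)
pose k1 := pb *: h i - pi *: h b; pose k2 := pc *: h i - pi *: h c.
have k1W : [/\ k1 i 0 = pb, k1 b 0 = - pi & k1 c 0 = 0].
  rewrite !mxE !hW // !eqxx (negbTE ib) (negbTE ci) (negbTE cb) (negbTE bi).
  by rewrite !mulr0 !mulr1 !subr0 sub0r.
have k2W : [/\ k2 i 0 = pc, k2 b 0 = 0 & k2 c 0 = - pi].
  rewrite !mxE !hW // !eqxx (negbTE ic) (negbTE bc) (negbTE ci) (negbTE bi).
  by rewrite !mulr0 !mulr1 !subr0 sub0r.
have [[k1i k1b k1c] [k2i k2b k2c]] := (k1W, k2W).
have Ak1 : A *m k1 = 0.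
  apply/kerA; rewrite k1i k1b k1c scale0r addr0 scaleNr; split=> //; ring.
have Ak2 : A *m k2 = 0.
  apply/kerA; rewrite k2i k2b k2c scale0r addr0 scaleNr; split=> //; ring.
pose N := col_mx k1^T k2^T.
have rankN : \rank N = 2%N.
  apply/eqP; rewrite -[_ == _]/(row_free N); apply: inj_row_free => v.
  rewrite -[v]hsubmxK mul_row_col; set s := lsubmx v; set t := rsubmx v => vN.
  have entry u : s 0 0 * k1 u 0 + t 0 0 * k2 u 0 = 0.
    move: vN; move: (k1) (k2) (s) (t) => f g s' t' /rowP/(_ u).
    by rewrite !mxE !big_ord1 !mxE.
  have := entry b; rewrite k1b k2b mulr0 addr0 => /eqP.
  rewrite mulf_eq0 oppr_eq0 (negbTE pi0) orbF => /eqP s0.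
  have := entry c; rewrite k1c k2c mulr0 add0r => /eqP.
  rewrite mulf_eq0 oppr_eq0 (negbTE pi0) orbF => /eqP t0.
  by rewrite [s]mx11_scalar [t]mx11_scalar s0 t0 !raddf0 row_mx0.
have null2 : \rank (kermx A) = 2%N.
  rewrite -rankN; apply/eqP; rewrite eqn_leq; apply/andP; split; apply: mxrankS.
    apply/rV_subP => v /sub_kermxP/kerA_tr/kerA[]; rewrite !mxE => Ev pv.
    have -> : v = (- (v 0 b / pi)) *: k1^T + (- (v 0 c / pi)) *: k2^T.
      apply: trmx_inj; rewrite Ev linearD !linearZ /= !trmxK /k1 /k2.
      apply/colP => u; rewrite !mxE.
      have -> : v 0 i = - (pb * v 0 b + pc * v 0 c) / pi.
        apply: (mulfI pi0); rewrite [RHS]mulrC divfK //; apply/eqP.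
        by rewrite -subr_eq0 opprK addrA pv.
      by field.
    rewrite addmx_sub // scalemx_sub //.
      by rewrite -addsmxE addsmxSl.
    by rewrite -addsmxE addsmxSr.
  apply/sub_kermxP; rewrite mul_col_mx; apply/eqP; rewrite col_mx_eq0.
  by apply/andP; split; apply/eqP/kerA_tr; rewrite trmxK.
have k1A : k1^T *m A = 0 by apply/kerA_tr; rewrite trmxK.
have k1i0 : k1^T 0 i != 0 by rewrite mxE k1i.
exists A; split=> //.
  (* Since [k1] is nonzero at [i], the deletion keeps the rank and lowers the order by one, so the
     nullity drops to 1. *)
  rewrite /nullity_pair nullity_kermx null2; congr pair.
  rewrite nullity_kermx mxrank_ker /del_row_col (mxrank_del_null symA k1A k1i0).
  by move: null2; rewrite mxrank_ker -subn1 subnAC => ->.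
move=> X symX _ diagX rowAX.
have X0 u : X u u = 0.
  by have /matrixP/(_ u u) := diagX; rewrite !mxE eqxx mul1r.
(* Only row [i] of [A *m X] is in question; multiplying by [k1^T], which annihilates [A] and is
   nonzero at [i], shows that it vanishes. *)
have AX : A *m X = 0.
  apply/row_matrixP => u; rewrite row0; case: (unliftP i u) => [v|] ->.
    by have /row_matrixP/(_ v) := rowAX; rewrite row0 => <-; apply/rowP => w; rewrite !mxE.
  have := mulmx_split_index k1^T (A *m X) i; rewrite rowAX mulmx0 addr0 mulmxA k1A mul0mx.
  move/rowP => E; apply/rowP => w; move: (E w).
  rewrite mxE [RHS]mxE big_ord1 [col _ _ _ _]mxE => /esym/eqP.
  by rewrite mulf_eq0 (negbTE k1i0) => /eqP ->.
have colX u : A *m col u X = 0 by rewrite colE mulmxA AX mul0mx.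
have XC u v : X u v = X v u by rewrite -{1}symX mxE.
have pX u : pi * X i u + pb * X b u + pc * X c u = 0.
  by have /kerA[_] := colX u; rewrite !mxE.
have [[pXi pXb] pXc] := (pX i, pX b, pX c).
rewrite X0 (XC b i) (XC c i) in pXi; rewrite X0 (XC c b) in pXb; rewrite X0 in pXc.
have cancel2 (p q y : R) : p != 0 -> q != 0 -> 2 * (p * q * y) = 0 -> y = 0.
  move=> p0 q0 /eqP; rewrite !mulf_eq0 (negbTE p0) (negbTE q0) pnatr_eq0 /=.
  by move/eqP.
(* Columns [i], [b], [c] of [X] give three linear equations in [X i b], [X i c], [X b c]. Each
   combination below isolates twice one unknown, with a nonzero coefficient. *)
have Xbc : X b c = 0.
  apply: (cancel2 pb pc) => //.
  have -> : 2 * (pb * pc * X b c) = pb * (pi * X i b + pb * 0 + pc * X b c)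
    + pc * (pi * X i c + pb * X b c + pc * 0) - pi * (pi * 0 + pb * X i b + pc * X i c).
    by ring.
  by rewrite pXi pXb pXc; ring.
have Xib : X i b = 0.
  apply: (cancel2 pi pb) => //.
  have -> : 2 * (pi * pb * X i b) = pb * (pi * X i b + pb * 0 + pc * X b c)
    - pc * (pi * X i c + pb * X b c + pc * 0) + pi * (pi * 0 + pb * X i b + pc * X i c).
    by ring.
  by rewrite pXi pXb pXc; ring.
have Xic : X i c = 0.
  apply: (cancel2 pi pc) => //.
  have -> : 2 * (pi * pc * X i c) = - pb * (pi * X i b + pb * 0 + pc * X b c)
    + pc * (pi * X i c + pb * X b c + pc * 0) + pi * (pi * 0 + pb * X i b + pc * X i c).
    by ring.
  by rewrite pXi pXb pXc; ring.
have colX0 a : X i a = 0 -> X b a = 0 -> X c a = 0 -> forall u, X u a = 0.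
  move=> ia ba ca u; have /kerA[/colP/(_ u)] := colX a.
  by rewrite !mxE ia ba ca !mul0r !addr0.
(* Columns [i], [b], [c] vanish first. By symmetry every column then vanishes on the tripod, and
   [colX0] applies again. *)
have Xi := colX0 i (X0 i) (etrans (XC b i) Xib) (etrans (XC c i) Xic).
have Xb := colX0 b Xib (X0 b) (etrans (XC c b) Xbc).
have Xc := colX0 c Xic Xbc (X0 c).
by apply/matrixP => u v; rewrite [RHS]mxE colX0 // XC.
Qed.

End TripodMatrix.

Theorem theorem5p3 (R : realType) (n : nat) (G : sgraph n) (i : 'I_n)
    (hG : connected_graph G) :
  [<-> allows_SNIP R G i 2 1;
       allows R G i 2 1;
       rooted_minor K3_rooted (RGraph G i) \/
         rooted_minor K13_leaf (RGraph G i);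
       ~ is_path G /\ ~ generalized_star_with_center G i].
Proof.
tfae.
- by case=> A [GA null21 _]; exists A.
- case=> A [GA null21]; apply: has_tripod_has_minor => //=.
  exact: nullity_pair_tripod GA hG null21.
- move=> minors; have /has_tripodP[b [c ibc]] : has_tripod G i.
    by case: minors => /has_tripod_minor; apply; [exact: tripod_K3 | exact: tripod_K13].
  split=> [pathG|starG].
    by have := path_no_tripod i b c pathG; rewrite ibc.
  by have := generalized_star_no_tripod b c starG; rewrite ibc.
- case=> nopath nostar; apply: tripod_allows_SNIP; apply: contraT => noT.
  by case: (no_tripod_shape hG noT).
Qed.
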